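(* Let $N$ be a finite set, let $A,B,C\subseteq N$ be pairwise disjoint with $A,B$ non-empty, and let $u$ be an elementary imset over $N$. Then $u$ belongs to $\mathcal{E}_{\langle A,B\,|\,C\rangle}$ if and only if $$\langle u,f\rangle=0\quad\text{for all } f\in\mathcal{M}_{\langle A,B\,|\,C\rangle}.$$
   Context: Unions of sets are written by juxtaposition ($AB=A\cup B$) and singletons $\{i\}$ as $i$; $\subset$ denotes proper inclusion. Functions $\mathcal{P}(N)\to\mathbb{R}$ on the power set of $N$ are identified with vectors in $\mathbb{R}^{2^{|N|}}$, with standard inner product $\langle\cdot,\cdot\rangle$. For $A\subseteq N$, $\delta_A(S)=1$ if $S=A$ and $0$ otherwise. For distinct $a,b\in N$ and $\Gamma\subseteq N\setminus\{a,b\}$ the elementary imset is $u_{\langle a,b\,|\,\Gamma\rangle}=\delta_{ab\Gamma}+\delta_\Gamma-\delta_{a\Gamma}-\delta_{b\Gamma}$. Define $\mathcal{E}_{\langle A,B|C\rangle}=\{u_{\langle a,b|\Gamma\rangle}\mid a\in A,\ b\in B,\ C\subseteq\Gamma\subseteq ABC\}$ (with $a,b\notin\Gamma$). For $E\subseteq N$ let $1_{E\subseteq\bullet}(S)=1$ if $E\subseteq S$ and $0$ otherwise, and $1_{E\supseteq\bullet}(S)=1$ if $E\supseteq S$ and $0$ otherwise. With $D=N\setminus(ABC)$, $\mathcal{M}_{\langle A,B|C\rangle}$ is the set of the following functions on $\mathcal{P}(N)$: - $1_{A_1C\subseteq\bullet}$ for $A_1\subseteq A$; - $1_{B_1C\subseteq\bullet}$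 for $\emptyset\ne B_1\subseteq B$; - $1_{EC_1\supseteq\bullet}$ for $E\subseteq AB$, $C_1\subset C$ (proper subset); - $1_{ED_1\subseteq\bullet}$ for $E\subseteq ABC$, $\emptyset\ne D_1\subseteq D$. *)

(* Defs.v *)
From mathcomp Require Import all_boot all_order all_algebra.
From mathcomp Require Import classical_sets reals.

Set Implicit Arguments.
Unset Strict Implicit.
Unset Printing Implicit Defensive.

Import GRing.Theory.
Local Open Scope ring_scope.

(* The finite ground set is the whole finType N, so its power set is {set N}.
   {set N} is a finite set (finset), whereas set (vec R N) is a Prop-valued
   set (classical_sets), since vec R N is not a finite type. *)
Notation vec R N := {ffun {set N} -> R}.

Section Imsets.
Variables (R : realType) (N : finType).
Implicit Types (A B C E S : {set N}) (u f : vec R N) (a b : N).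

Definition inner u f : R := \sum_(S : {set N}) u S * f S.

Definition delta A : vec R N := [ffun S => (S == A)%:R].

Definition elem_imset a b (G : {set N}) : vec R N :=
  delta (a |: (b |: G)) + delta G - delta (a |: G) - delta (b |: G).

(* elem_imset a b G is an elementary imset only when elem_triple a b G holds. *)
Definition elem_triple a b (G : {set N}) : bool :=
  (a != b) && (G \subset ~: [set a; b]).

Definition elementary_imsets : set (vec R N) :=
  fun u => exists a b (G : {set N}), elem_triple a b G /\ u = elem_imset a b G.

Definition elementary_imsets_of A B C : set (vec R N) :=
  fun u => exists a b (G : {set N}),
    [/\ elem_triple a b G, a \in A, b \in B,
        C \subset G /\ G \subset A :|: B :|: C & u = elem_imset a b G].

Definition ind_up E : vec R N := [ffun S : {set N} => (E \subset S)%:R].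

Definition ind_down E : vec R N := [ffun S : {set N} => (S \subset E)%:R].

Definition test_functions A B C : set (vec R N) :=
  let D := ~: (A :|: B :|: C) in
  fun f =>
    [\/ exists2 A1 : {set N}, A1 \subset A & f = ind_up (A1 :|: C),
        exists B1 : {set N},
          [/\ B1 != finset.set0, B1 \subset B & f = ind_up (B1 :|: C)],
        exists E C1 : {set N},
          [/\ E \subset A :|: B, C1 \proper C & f = ind_down (E :|: C1)]
      | exists E D1 : {set N},
          [/\ E \subset A :|: B :|: C, D1 != finset.set0, D1 \subset D
            & f = ind_up (E :|: D1)]].

End Imsets.

(* Main.v *)
Require Import Defs.
From mathcomp Require Import all_boot all_order all_algebra.
From mathcomp Require Import classical_sets reals.

(* Pairing [u_<a,b|G>] with [1_{E <= .}] gives the indicator of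
   [a, b \in E <= abG], and pairing it with [1_{E >= .}] the indicator of
   [G <= E], [a, b \notin E]. The tests of [M_<A,B|C>] then vanish on
   [E_<A,B|C>]; conversely the choices [ED1 = abG], [EC1 = G], [A1 = ab] and
   [B1 = ab] force in turn [abG <= ABC], [C <= G], and that [a], [b] lie neither
   both in [A] nor both in [B]. *)

Local Open Scope ring_scope.

Import fintype boot.finset GRing.Theory.

Lemma inner_delta (R : realType) (N : finType) (A : {set N})
    (f : {ffun {set N} -> R}) : inner (delta R A) f = f A.
Proof.
rewrite /inner (bigD1 A) //= ffunE eqxx mul1r big1 ?addr0 // => S /negbTE nSA.
by rewrite ffunE nSA mul0r.
Qed.

Lemma innerD (R : realType) (N : finType) (u v f : {ffun {set N} -> R}) :
  inner (u + v) f = inner u f + inner v f.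
Proof.
by rewrite /inner -big_split; apply: eq_bigr => S _; rewrite ffunE mulrDl.
Qed.

Lemma innerN (R : realType) (N : finType) (u f : {ffun {set N} -> R}) :
  inner (- u) f = - inner u f.
Proof.
by rewrite /inner -sumrN; apply: eq_bigr => S _; rewrite ffunE mulNr.
Qed.

Lemma inner_elem_imset (R : realType) (N : finType) (a b : N) (G : {set N})
    (f : {ffun {set N} -> R}) :
  inner (elem_imset R a b G) f =
    f (a |: (b |: G)) + f G - f (a |: G) - f (b |: G).
Proof. by rewrite /elem_imset !(innerD, innerN) !inner_delta. Qed.

Lemma elem_imsetC (R : realType) (N : finType) (a b : N) (G : {set N}) :
  elem_imset R a b G = elem_imset R b a G.
Proof. by rewrite /elem_imset setUCA -addrA [- _ - _]addrC addrA. Qed.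

Lemma elem_tripleP (N : finType) (a b : N) (G : {set N}) :
  reflect [/\ a != b, a \notin G & b \notin G] (elem_triple a b G).
Proof.
rewrite /elem_triple subsetC subUset !sub1set !inE.
exact: and3P.
Qed.

Lemma elem_tripleC (N : finType) (a b : N) (G : {set N}) :
  elem_triple a b G = elem_triple b a G.
Proof. by rewrite /elem_triple eq_sym setUC. Qed.

Lemma subsetU1_notin {N : finType} {x : N} {E S : {set N}} :
  x \notin E -> (E \subset x |: S) = (E \subset S).
Proof.
move=> xE; apply/subsetP/subsetP => ES y yE; last by rewrite !inE ES ?orbT.
by have := ES y yE; rewrite !inE; case: eqP => // yx; rewrite -yx yE in xE.
Qed.

Lemma subset_notin {N : finType} {x : N} {E S : {set N}} :
  x \in E -> x \notin S -> (E \subset S) = false.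
Proof. by move=> xE xS; apply: contraNF xS => /subsetP->. Qed.

(** If [a] is not in [E], adding [a] to a set does not affect whether it contains [E], so the four
    terms cancel in pairs; likewise for [b]. If both lie in [E], only the term at [abG] can
    survive. *)
Lemma inner_ind_up (R : realType) (N : finType) (a b : N) (G E : {set N}) :
  elem_triple a b G ->
  inner (elem_imset R a b G) (ind_up R E) =
    [&& a \in E, b \in E & E \subset a |: (b |: G)]%:R.
Proof.
move=> /elem_tripleP[nab aG bG]; rewrite inner_elem_imset !ffunE.
case: (boolP (a \in E)) => aE /=; last first.
  by rewrite !(subsetU1_notin aE) addrK subrr.
case: (boolP (b \in E)) => bE /=; last first.
  by rewrite setUCA !(subsetU1_notin bE) addrAC addrK subrr.
have abG : a \notin b |: G by rewrite !inE negb_or nab.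
have baG : b \notin a |: G by rewrite !inE negb_or eq_sym nab.
by rewrite (subset_notin aE aG) (subset_notin aE abG) (subset_notin bE baG)
  addr0 !subr0.
Qed.

(** Inclusion in [E] is tested point by point, so the alternating sum factors as [[G <= E] (1 -
    [a \in E]) (1 - [b \in E])]. *)
Lemma inner_ind_down (R : realType) (N : finType) (a b : N) (G E : {set N}) :
  inner (elem_imset R a b G) (ind_down R E) =
    [&& a \notin E, b \notin E & G \subset E]%:R.
Proof.
rewrite inner_elem_imset !ffunE !subUset !sub1set.
by case: (a \in E); case: (b \in E); case: (G \subset E);
  rewrite /= ?(addr0, subr0, addrK, subrr, add0r).
Qed.

Lemma elem_imset_of_test0 (R : realType) (N : finType) (A B C : {set N})
    (u f : {ffun {set N} -> R}) :
  [disjoint A & B] -> [disjoint A & C] -> [disjoint B & C] ->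
  elementary_imsets_of A B C u -> test_functions A B C f -> inner u f = 0.
Proof.
move=> dAB dAC dBC [a [b [G [abG aA bB [sCG sG] ->]]]].
have sabG : a |: (b |: G) \subset A :|: B :|: C.
  by rewrite !subUset !sub1set !inE aA bB orbT.
case=> [[A1 sA1 ->]|[B1 [_ sB1 ->]]|[E [C1 [sE pC1 ->]]]|[E [D1 [_ D0 sD1 ->]]]].
(* As [B] is disjoint from [A] and [C], [b] lies outside [A1 :|: C]; the next family is symmetric,
   with [a] outside [B1 :|: C]. *)
- rewrite inner_ind_up // [b \in _]inE (disjointFr dBC bB) orbF.
  have /negbTE-> : b \notin A1.
    by apply: contraFN (disjointFl dAB bB) => /(subsetP sA1).
  by rewrite andbF.
- rewrite inner_ind_up // [a \in _]inE (disjointFr dAC aA) orbF.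
  have /negbTE-> // : a \notin B1.
  by apply: contraFN (disjointFr dAB aA) => /(subsetP sB1).
(* Since [C <= G], the inclusion of [G] in [E :|: C1] would force a point of [C] outside [C1] into
   [E <= AB]. *)
- rewrite inner_ind_down; case: (boolP (G \subset _)) => [sGE|]; last first.
    by rewrite !andbF.
  have /properP[_ [x xC /negP[]]] := pC1.
  have := subsetP sGE x (subsetP sCG x xC); rewrite inE => /orP[/(subsetP sE)|//].
  by rewrite inE (disjointFl dAC xC) (disjointFl dBC xC).
(* A point of [D1] lies outside [ABC], hence outside [abG]. *)
- rewrite inner_ind_up //; case: (boolP (_ :|: _ \subset _)) => [sED|]; last first.
    by rewrite !andbF.
  have /set0Pn[x xD1] := D0.
  have := subsetP sD1 x xD1; rewrite in_setC => /negP[].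
  by apply/(subsetP sabG)/(subsetP sED); rewrite inE xD1 orbT.
Qed.

Lemma test0_elem_imset_of (R : realType) (N : finType) (A B C : {set N})
    (u : {ffun {set N} -> R}) :
  elementary_imsets u ->
  (forall f : {ffun {set N} -> R}, test_functions A B C f -> inner u f = 0) ->
  elementary_imsets_of A B C u.
Proof.
move=> [a [b [G [abG ->]]]] test0.
have /elem_tripleP[nab aG bG] := abG.
have test_up E : test_functions A B C (ind_up R E) ->
    ~~ [&& a \in E, b \in E & E \subset a |: (b |: G)].
  move/test0; rewrite inner_ind_up //.
  by case: [&& _, _ & _] => // /eqP; rewrite oner_eq0.
have test_down E : test_functions A B C (ind_down R E) ->
    ~~ [&& a \notin E, b \notin E & G \subset E].
  move/test0; rewrite inner_ind_down.
  by case: [&& _, _ & _] => // /eqP; rewrite oner_eq0.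
have sabG : a |: (b |: G) \subset A :|: B :|: C.
  set T := a |: _; set K := A :|: B :|: C; apply: contraT => nTK.
  have := test_up T; rewrite /T !inE !eqxx orbT subxx; apply.
  (* Split [abG] along [ABC]: the part outside is non-empty by [nTK] and serves as [D1]. *)
  apply: Or44; exists (T :&: K), (T :&: ~: K); split.
  - exact: subsetIr.
  - by rewrite -setDE setD_eq0.
  - exact: subsetIr.
  - by rewrite -setIUr setUCr setIT.
have sC : C \subset G.
  apply: contraT => nCG.
  have := test_down G; rewrite aG bG subxx; apply.
  (* These two pieces recover [G] because [sabG] already gives [G <= ABC]; the second is proper in
     [C] exactly because [C] is not inside [G]. *)
  apply: Or43; exists (G :&: (A :|: B)), (G :&: C); split.
  - exact: subsetIr.
  - rewrite properE subsetIr /=; apply: contra nCG.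
    by rewrite subsetI => /andP[].
  - rewrite -setIUr (setIidPl _) //.
    by apply: subset_trans sabG; rewrite setUA subsetUr.
move: sabG; rewrite !subUset !sub1set => /and3P[aK bK sG].
have inAB x : x \notin G -> x \in A :|: B :|: C -> (x \in A) || (x \in B).
  move=> xG; rewrite !inE => /orP[//|/(subsetP sC) xG'].
  by rewrite xG' in xG.
(* The up-test at [abC] therefore pairs to 1, so it cannot be in the test family, as it would be if
   [a] and [b] shared the side [A] or the side [B]. *)
have sCT : [set a; b] :|: C \subset a |: (b |: G).
  by rewrite setUA; apply: setUS.
have nA : ~~ ((a \in A) && (b \in A)).
  apply/negP => /andP[aA bA].
  have := test_up ([set a; b] :|: C); rewrite sCT !inE !eqxx orbT /=.
  move=> /(_ _)/negP; apply => //.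
  by apply: Or41; exists [set a; b]; rewrite // subUset !sub1set aA.
have nB : ~~ ((a \in B) && (b \in B)).
  apply/negP => /andP[aB bB].
  have := test_up ([set a; b] :|: C); rewrite sCT !inE !eqxx orbT /=.
  move=> /(_ _)/negP; apply => //.
  apply: Or42; exists [set a; b]; split => //.
    by apply/set0Pn; exists a; rewrite !inE eqxx.
  by rewrite subUset !sub1set aB.
case/orP: (inAB _ aG aK) => [aA|aB].
  exists a, b, G; split => //.
  by case/orP: (inAB _ bG bK) => // bA; rewrite aA bA in nA.
(* When [a] lies in [B], the symmetry of the imset lets [b] play the role of the element of [A]. *)
exists b, a, G; split => //; [by rewrite elem_tripleC| |exact: elem_imsetC].
by case/orP: (inAB _ bG bK) => // bB; rewrite aB bB in nB.
Qed.

Theorem theorem5p1 (R : realType) (N : finType) (A B C : {set N})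
    (u : {ffun {set N} -> R})
    (dAB : [disjoint A & B]) (dAC : [disjoint A & C]) (dBC : [disjoint B & C])
    (A0 : A != finset.set0) (B0 : B != finset.set0)
    (hu : elementary_imsets u) :
  elementary_imsets_of A B C u <->
  (forall f : {ffun {set N} -> R}, test_functions A B C f -> inner u f = 0).
Proof.
split=> [uE f|]; last exact: test0_elem_imset_of.
exact: elem_imset_of_test0.
Qed.
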